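(* Let $(X,d)$ be a compact metric space and let $\mathcal{M}(X)$ be the set of Borel probability measures on $X$ endowed with the weak*-topology. If $\phi$ is a continuous flow on $X$ without fixed points, then the set of expansive measures for $\phi$ is a $G_{\delta\sigma}$-subset of $\mathcal{M}(X)$. Moreover, every expansive measure for $\phi$ is weak*-accumulated by expansive measures for $\phi$ whose support is $\phi$-invariant; that is, every expansive measure is the weak*-limit of a sequence of expansive measures $\nu$ for $\phi$ such that $\phi_t(\operatorname{supp}(\nu))=\operatorname{supp}(\nu)$ for all $t\in\mathbb{R}$.
   Context: A continuous flow on $X$ is a continuous map $\phi:\mathbb{R}\times X\to X$ with $\phi(0,x)=x$ and $\phi(t+s,x)=\phi(s,\phi(t,x))$; write $\phi_t=\phi(t,\cdot)$. A point $x$ is fixed if $\phi_t(x)=x$ for all $t$. A $G_{\delta\sigma}$-set is a countable union of $G_\delta$ sets (countable intersections of open sets). Let $\mathcal{C}^0$ be the set of continuous functions $h:\mathbb{R}\to\mathbb{R}$ with $h(0)=0$. For $x\in X$ and $\varepsilon>0$ put $$\tilde\Gamma_\varepsilon(x)=\{y\in X:\ \exists h\in\mathcal{C}^0 \text{ such that } d(\phi_s(x),\phi_{h(s)}(y))\le\varepsilon\ \ \forall s\in\mathbb{R}\}.$$ A measure $\mu\in\mathcal{M}(X)$ (not required to be $\phi$-invariant) is expansive for $\phi$ if there exists $\varepsilon>0$ such that $\mu(\tilde\Gamma_\varepsilon(x))=0$ for every $x\in X$. For a not necessarily Borel set $A\subseteq X$, $\mu(A)=0$ means $\mu(B)=0$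 for every Borel set $B\subseteq A$. *)

(* Defs.v *)
From HB Require Import structures.
From mathcomp Require Import all_boot all_order all_algebra.
From mathcomp Require Import all_classical all_reals all_analysis.
From mathcomp Require Import borel_hierarchy.

Set Implicit Arguments.
Unset Strict Implicit.
Unset Printing Implicit Defensive.

Import Order.TTheory GRing.Theory Num.Theory.
Import numFieldNormedType.Exports.

Local Open Scope classical_set_scope.
Local Open Scope ring_scope.

(* Measurable types are pointed in the library, so a metric space carrying
   Borel measures comes with a point. On the empty space there is no
   probability measure at all. *)
#[short(type="pointedMetricType")]
HB.structure Definition PointedMetric (K : numDomainType) :=
  {T of Pointed T & Metric K T}.

Definition Gdelta_sigma {T : topologicalType} (S : set T) :=
  exists2 F : (set T)^nat, (forall i, Gdelta (F i)) & S = \bigcup_i F i.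

Definition borel (X : ptopologicalType) : Type := g_sigma_algebraType (@open X).
HB.instance Definition _ (X : ptopologicalType) :=
  Measurable.copy (borel X) (g_sigma_algebraType (@open X)).

Section weakstar_topology.
Context {R : realType} (X : pointedMetricType R).

Definition integrate (mu : probability (borel X) R) :
    {ptws continuousType X R -> R} :=
  fun f => (\int[mu]_x f x)%R.

(* For compact X: the weak* topology, i.e. the coarsest one making
   mu |-> \int f dmu continuous for every continuous f : X -> R. *)
Definition borelProbability : Type := initial_topology integrate.
HB.instance Definition _ :=
  Topological.copy borelProbability (initial_topology integrate).

End weakstar_topology.
Arguments borelProbability {R} X.

Section flows.
Context {R : realType} {X : pointedMetricType R}.
Implicit Types (phi : R -> X -> X) (mu : probability (borel X) R).

Definition continuous_flow phi :=
  [/\ continuous (fun p : R * X => phi p.1 p.2),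
      forall x, phi 0 x = x &
      forall t s x, phi (t + s) x = phi s (phi t x)].

Definition fixed_point phi (x : X) := forall t, phi t x = x.

Definition Gamma_tilde phi (e : R) (x : X) : set X :=
  [set y | exists h : R -> R,
    [/\ continuous h, h 0 = 0 &
        forall s, mdist (phi s x) (phi (h s) y) <= e]].

(* Unlike mu.-negligible A, which asks that A be contained in a null Borel
   set, this is vanishing of the inner measure of A. *)
Definition inner_null mu (A : set X) :=
  forall B : set (borel X), measurable B -> B `<=` A -> mu B = 0%E.

Definition expansive phi mu :=
  exists2 e : R, 0 < e & forall x, inner_null mu (Gamma_tilde phi e x).

Definition supp mu : set X :=
  [set x | forall U : set X, open U -> U x -> (0 < mu U)%E].

Definition flow_invariant phi (A : set X) := forall t, phi t @` A = A.

End flows.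

(* Main.v *)
Require Import Defs.
From HB Require Import structures.
From mathcomp Require Import all_boot all_order all_algebra.
From mathcomp Require Import all_classical all_reals all_analysis.
From mathcomp Require Import borel_hierarchy.
From mathcomp Require Import measurable_realfun lra.

Set Implicit Arguments.
Unset Strict Implicit.
Unset Printing Implicit Defensive.

Import Order.TTheory GRing.Theory Num.Theory.
Import numFieldNormedType.Exports.

Local Open Scope classical_set_scope.
Local Open Scope ring_scope.

(** Expansivity is defined by the sets [Gamma_tilde phi e x], which involve all
continuous reparametrizations and need not be closed. The proof rests on
replacing them by closed sets.

Without fixed points there are no arbitrarily short periods
([no_short_period]), so some small time [r] displaces every point by at least a
fixed amount. If the orbit of [y], run on a clock [h], stays very close to the
orbit of [x], then over one unit of time [h] cannot gain or lose [r]: by the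
intermediate value theorem it would do so exactly at some instant, and there a
point and its displacement by time [r] would be too close. Hence [h] advances
by almost [s] during every time [s] in the unit interval ([shadow_speed]),
which has two consequences. First, [h] is surjective ([shadow_surjective]).
Second, [h] is uniformly close to a 2-Lipschitz function
([slow_approximation]), so that [Gamma_tilde phi e x] is contained in the set
[slow_shadow phi e' x] of points that follow [x] within [e'] along a
2-Lipschitz reparametrization, where [e] depends on [e'] only
([Gamma_sub_slow_shadow]). The 2-Lipschitz functions vanishing at [0] form a
compact set for pointwise convergence, so [y \in slow_shadow phi e x] is a
closed relation in [(x, y)] ([closed_slow_shadow]). Thus a measure is expansive
if and only if for some [e] it vanishes on all the closed sets
[slow_shadow phi e x] ([expansiveP]).

For a closed relation on a compact space, the condition that every section has
measure less than [c] is weak* open in the measure ([open_all_section_lt]).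
Vanishing on all sections is the intersection of these conditions over
[c = 1 / (k + 1)], and a union over [e = 1 / (n + 1)] gives the first claim.

For the second claim, let [rho] be a mixture of the images of [mu] under the
maps [phi q] for all rational [q]. Its support is invariant under rational
times, hence under all times since supports are closed. The mixtures
[(1 - a) mu + a rho] converge to [mu] as [a] tends to [0], and for [0 < a] they
have the null sets of [rho], so it remains to show that [rho] is expansive. Here
surjectivity enters: if [phi t y] follows [x] along [h], then [y] follows
[phi s x] for any [s] with [h s = - t]. After enlarging [e] one may move [s]
to a nearby rational number, so that the preimage under [phi t] of a set
[slow_shadow phi e' x] is covered by countably many sets
[slow_shadow phi e (phi q x)] ([slow_shadow_shift]). These are null for [mu]. *)

(** * Uniform estimates on compact metric spaces *)

Lemma exists_invS_lt {R : realType} (e : R) : 0 < e ->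
  exists n : nat, n.+1%:R^-1 < e.
Proof.
by move=> e0; exists (Num.truncn e^-1); rewrite invf_plt ?posrE// truncnS_gt.
Qed.

Section compact_metric.
Context {R : realType} {X : pointedMetricType R}.

Lemma mdist_sym (x y : X) : mdist x y = mdist y x.
Proof. exact: metric_sym. Qed.

Lemma mdist_triangle (y x z : X) : mdist x z <= mdist x y + mdist y z.
Proof. exact: metric_triangle. Qed.

Lemma mdist_continuous : continuous (fun p : X * X => mdist p.1 p.2).
Proof.
move=> [x y]; apply/cvgrPdist_le => /= e e0.
near=> p => /=.
have px : mdist x p.1 < e / 2.
  near: p; apply: (metricType_numDomainType.cvgr_dist_lt (y := x)).
  - exact: (@cvg_fst X X (nbhs x) (nbhs y)).
  - by rewrite divr_gt0.
have py : mdist y p.2 < e / 2.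
  near: p; apply: (metricType_numDomainType.cvgr_dist_lt (y := y)).
  - exact: (@cvg_snd X X (nbhs x) (nbhs y)).
  - by rewrite divr_gt0.
have h1 := mdist_triangle p.1 x y.
have h2 := mdist_triangle p.2 p.1 y.
have h3 := mdist_triangle x p.1 p.2.
have h4 := mdist_triangle y x p.2.
rewrite (mdist_sym p.2 y) in h2; rewrite (mdist_sym p.1 x) in h3.
rewrite ler_norml; apply/andP; split; lra.
Unshelve. all: by end_near. Qed.

(** A bound that holds locally for all small [e] holds everywhere for a single
[e]. *)
Lemma compact_near_right (P : R -> X -> Prop) : compact [set: X] ->
  (forall x : X, \forall x' \near x & e \near 0^'+, P e x') ->
  exists2 e : R, 0 < e & forall x, P e x.
Proof.
move=> /compact_near_coveringP cX H.
have K : \forall e \near 0^'+, [set: X] `<=` P e.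
  by apply: (cX _ _ P) => x _; exact: H.
near (0 : R)^'+ => e; exists e => // x.
exact: (near K e).
Unshelve. all: by end_near. Qed.

Lemma near_ge_right (f : X -> R) (x : X) : {for x, continuous f} -> 0 < f x ->
  \forall x' \near x & e \near 0^'+, e <= f x'.
Proof.
move=> fx f0; have f20 : 0 < f x / 2 by rewrite divr_gt0.
exists ([set x' | f x / 2 < f x'], [set e | e < f x / 2]) => /=; first split.
- by move: fx => /cvgr_gt; apply; rewrite ltr_pdivrMr// ltr_pMr// ltr1n.
- exact: nbhs_right_lt.
- by move=> [y e]/= [h1 h2]; rewrite ltW// (lt_trans h2).
Qed.

Lemma positive_bounded_below (f : X -> R) : compact [set: X] -> continuous f ->
  (forall x, 0 < f x) ->
  exists2 g, 0 < g & forall x, g <= f x.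
Proof.
move=> compactX cf f0; apply: (compact_near_right compactX) => x.
by apply: near_ge_right; [exact: cf|exact: f0].
Qed.

Lemma continuous_bounded (f : X -> R) : compact [set: X] -> continuous f ->
  [bounded f x | x in [set: X]].
Proof.
move=> compactX cf.
have /compact_bounded [M [Mreal hM]] : compact (f @` [set: X]).
  by apply: continuous_compact => //; exact: continuous_subspaceT.
by exists M; split => // N MN x _; apply: (hM N MN); exists x.
Qed.

End compact_metric.

(** * Flows without fixed points *)

Section flow.
Context {R : realType} {X : pointedMetricType R} (phi : R -> X -> X).
Context (compactX : compact [set: X]).
Context (flow_phi : continuous_flow phi).

Lemma flow0 x : phi 0 x = x. Proof. by case: flow_phi. Qed.

Lemma flowD t s x : phi (t + s) x = phi s (phi t x).
Proof. by case: flow_phi. Qed.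

Lemma flow_cvg T (F : set_system T) (FF : Filter F) (f : T -> R) (g : T -> X)
    t x :
  f @ F --> t -> g @ F --> x -> phi (f z) (g z) @[z --> F] --> phi t x.
Proof.
move=> ft gx; case: flow_phi => c _ _.
have fg : (f z, g z) @[z --> F] --> (t, x).
  exact: (@cvg_pair _ _ _ F (nbhs t) (nbhs x) _ _ _ f g ft gx).
exact: (cvg_comp _ _ fg (c (t, x))).
Qed.

Lemma flow_continuous t : continuous (phi t).
Proof.
by move=> x; apply: flow_cvg; [exact: cvg_cst|exact: cvg_id].
Qed.

Lemma flow_preimage_open t (U : set X) : open U -> open (phi t @^-1` U).
Proof. by move/continuousP : (@flow_continuous t); exact. Qed.

Lemma flow_near_id e : 0 < e ->
  exists2 d, 0 < d & forall t x, `|t| <= d -> mdist (phi t x) x <= e.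
Proof.
move=> e0; move/compact_near_coveringP : compactX => cX.
have K : \forall t \near (0 : R),
    [set: X] `<=` [set x | mdist (phi t x) x <= e].
  apply: (cX _ (nbhs (0 : R)) (fun t x => mdist (phi t x) x <= e)) => x _.
  have : mdist (phi p.2 p.1) p.1 @[p --> (nbhs x, nbhs (0 : R))] -->
      mdist (phi 0 x) x.
    have h : (phi p.2 p.1, p.1) @[p --> (nbhs x, nbhs (0 : R))] -->
        (phi 0 x, x).
      apply: (@cvg_pair _ _ _ _ (nbhs (phi 0 x)) (nbhs x)); last exact: cvg_fst.
      by apply: flow_cvg; [exact: cvg_snd|exact: cvg_fst].
    exact: (cvg_comp _ _ h (@mdist_continuous _ _ (phi 0 x, x))).
  rewrite flow0 mdistxx => /cvgrPdist_le /(_ _ e0).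
  apply: filterS => p; rewrite sub0r normrN; apply: le_trans.
  exact: ler_norm.
case/nbhs_ballP : K => d /= d0 dK.
exists (d / 2); first by rewrite divr_gt0.
move=> t x td; apply: dK => //=; rewrite /ball/= sub0r normrN.
by rewrite (le_lt_trans td)// ltr_pdivrMr// ltr_pMr// ltr1n.
Qed.

(** Times are restricted to a compact interval, as nothing uniform can be said
for all times at once. *)
Lemma flow_equicontinuous e : 0 < e ->
  exists2 d, 0 < d & forall t x y, `|t| <= 1 -> mdist x y <= d ->
    mdist (phi t x) (phi t y) <= e.
Proof.
move=> e0.
have /compact_near_coveringP cX : compact (`[(-1 : R), 1] `*` [set: X]).
  by apply: compact_setX => //; exact: segment_compact.
have K : \forall d \near (0 : R)^'+, `[(-1 : R), 1] `*` [set: X] `<=`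
    [set p | forall y, mdist p.2 y <= d ->
      mdist (phi p.1 p.2) (phi p.1 y) <= e].
  apply: (cX _ _ (fun d p => forall y, mdist p.2 y <= d ->
      mdist (phi p.1 p.2) (phi p.1 y) <= e)) => -[t x] _.
  have e2 : 0 < e / 2 by rewrite divr_gt0.
  have [c _ _] := flow_phi.
  have /= := c (t, x).
  move=> /metricType_numDomainType.cvgr_dist_lt /(_ _ e2) [[A B] [/= At Bx] AB].
  move/nbhs_ballP : Bx => [r /= r0 rB].
  exists ((A `*` ball x (r / 2)), [set d | d < r / 2]); first split => /=.
  - exists (A, ball x (r / 2)) => //=; split => //; apply: nbhsx_ballx.
    by rewrite divr_gt0.
  - by apply: nbhs_right_lt; rewrite divr_gt0.
  move=> [[t' x'] d]/= [[At' xx'] dr] y xy'.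
  move: xx'; rewrite ballEmdist/= => xx'.
  have h1 := mdist_triangle x' x y.
  have h2 := mdist_triangle (phi t x) (phi t' x') (phi t' y).
  have h3 : mdist (phi t x) (phi t' x') < e / 2.
    apply: (AB (t', x')); split => //=; apply: rB; rewrite ballEmdist/=; lra.
  have h4 : mdist (phi t x) (phi t' y) < e / 2.
    apply: (AB (t', y)); split => //=; apply: rB; rewrite ballEmdist/=; lra.
  rewrite (mdist_sym (phi t' x') (phi t x)) in h2; lra.
near (0 : R)^'+ => d; exists d => // t x y t1 xy.
apply: (near K d _ (t, x)) => //=; split => //=.
by rewrite in_itv/= -ler_norml.
Unshelve. all: by end_near. Qed.

End flow.

Section no_fixed_points.
Context {R : realType} {X : pointedMetricType R} (phi : R -> X -> X).
Context (compactX : compact [set: X]).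
Context (flow_phi : continuous_flow phi).
Context (no_fixed_point : forall x : X, ~ fixed_point phi x).

Lemma displacement_continuous t : continuous (fun x => mdist (phi t x) x).
Proof.
move=> x.
have h : (phi t y, y) @[y --> x] --> (phi t x, x).
  apply: (@cvg_pair _ _ _ _ (nbhs (phi t x)) (nbhs x)); last exact: cvg_id.
  by apply: (flow_cvg flow_phi); [exact: cvg_cst|exact: cvg_id].
exact: (cvg_comp _ _ h (@mdist_continuous _ _ (phi t x, x))).
Qed.

(** Some time displaces [x] by a positive amount, and the same time works for
all neighbours of [x]; compactness makes the amount uniform. *)
Lemma displacement_bounded_below :
  exists2 e, 0 < e & forall x, exists t, e <= mdist (phi t x) x.
Proof.
apply: (compact_near_right compactX) => x.
have [t tx] : exists t, phi t x <> x by apply/existsNP/no_fixed_point.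
have := near_ge_right (@displacement_continuous t x).
rewrite mdist_gt0 => /(_ (introN eqP tx)).
by apply: filterS => -[x' e]/= h; exists t.
Qed.

Lemma flow_period t x (n : int) : phi t x = x -> phi (n%:~R * t) x = x.
Proof.
move=> tx; elim: n => [|n IH|n IH]; first by rewrite mul0r (flow0 flow_phi).
- by rewrite -addn1 PoszD intrD mulrDl mul1r (flowD flow_phi) IH.
- rewrite -addn1 PoszD opprD intrD mulrDl (flowD flow_phi) IH -{1}tx.
  by rewrite -(flowD flow_phi) mulNr mul1r subrr (flow0 flow_phi).
Qed.

(** A point of period [t] returns at all multiples of [t]. If [t] is small,
every time is near such a multiple, so that the point never moves far, against
[displacement_bounded_below]. *)
Lemma no_short_period :
  exists2 T, 0 < T & forall t x, 0 < t < T -> phi t x <> x.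
Proof.
have [e e0 he] := displacement_bounded_below.
have e20 : 0 < e / 2 by rewrite divr_gt0.
have [d d0 hd] := flow_near_id compactX flow_phi e20.
exists d => // t x /andP[t0 td] tx.
have [s] := he x.
have -> : s = (Num.floor (s / t))%:~R * t + (s - (Num.floor (s / t))%:~R * t).
  by rewrite addrC subrK.
rewrite (flowD flow_phi) (flow_period _ tx) => es.
have /andP[f1 f2] := real_floor_itv (num_real (s / t)).
move: f1 f2; rewrite ler_pdivlMr// ltr_pdivrMr// intrD mulrDl mul1r => f1 f2.
have := hd (s - (Num.floor (s / t))%:~R * t) x.
rewrite ger0_norm ?subr_ge0// => hds.
have : s - (Num.floor (s / t))%:~R * t <= d by lra.
move/hds; lra.
Qed.

Definition shadows e x y (h : R -> R) :=
  forall s, mdist (phi s x) (phi (h s) y) <= e.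

(** The point at which the lack of fixed points is used. A clock that strays by
more than [eta] within one unit of time strays by exactly [r <= eta] at some
instant; then, for [w] on the orbit of [y], both [w] and its image under
[phi r] or [phi (- r)] are close to the same point of the orbit of [x], although
[phi r] moves every point by a definite amount. *)
Lemma shadow_speed eta : 0 < eta ->
  exists2 e, 0 < e & forall x y h, continuous h -> shadows e x y h ->
    forall a s, `|s| <= 1 -> `|h (a + s) - h a - s| <= eta.
Proof.
move=> eta0; have [T T0 hT] := no_short_period.
pose r := Num.min eta (T / 2).
have r0 : 0 < r by rewrite lt_min eta0 divr_gt0.
have rT : r < T by rewrite gt_min; apply/orP; right; lra.
have [g g0 hg] : exists2 g, 0 < g & forall x, g <= mdist (phi r x) x.
  apply: (positive_bounded_below compactX).
    exact: displacement_continuous.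
  by move=> x; rewrite mdist_gt0; apply/eqP/hT; rewrite r0.
have hgN x : g <= mdist (phi (- r) x) x.
  have := hg (phi (- r) x).
  by rewrite -(flowD flow_phi) addNr (flow0 flow_phi) mdist_sym.
have g40 : 0 < g / 4 by rewrite divr_gt0.
have [d d0 hd] := flow_equicontinuous compactX flow_phi g40.
exists (Num.min d (g / 4)); first by rewrite lt_min d0.
move=> x y h ch sh a s s1; rewrite leNgt; apply/negP => es.
pose F u := `|h (a + u * s) - h a - u * s|.
have cF : continuous F.
  move=> u; apply: cvg_norm; apply: cvgB; last first.
    by apply: cvgM; [exact: cvg_id|exact: cvg_cst].
  apply: cvgB; last exact: cvg_cst.
  apply: continuous_cvg; first exact: ch.
  apply: cvgD; first exact: cvg_cst.
  by apply: cvgM; [exact: cvg_id|exact: cvg_cst].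
have [c c01 Fc] : exists2 c, c \in `[0, 1] & F c = r.
  apply: IVT => //; first exact: continuous_subspaceT.
  rewrite {1 3}/F !mul0r addr0 subrr subr0 normr0 /F !mul1r.
  rewrite min_l// max_r// ltW//=.
  by apply/ltW/(le_lt_trans _ es); rewrite ge_min lexx.
pose s' := c * s.
have s'1 : `|s'| <= 1.
  move: c01; rewrite in_itv/= => /andP[c0 c1].
  by rewrite normrM (ger0_norm c0) mulr_ile1.
(* [w] is where the orbit of [y] would be had the clock kept time since [a] *)
set w := phi s' (phi (h a) y).
have k1 : mdist (phi s' (phi a x)) w <= g / 4.
  by apply: hd => //; rewrite (le_trans (sh a))// ge_min lexx.
have k2 : mdist (phi s' (phi a x)) (phi (h (a + s')) y) <= g / 4.
  by rewrite -(flowD flow_phi) (le_trans (sh _))// ge_min lexx orbT.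
have k3 : g <= mdist (phi (h (a + s')) y) w.
  have : F c = r by [].
  rewrite /F -/s'; case: (ger0P (h (a + s') - h a - s')) => _ hr.
  - have -> : h (a + s') = h a + (s' + r) by lra.
    by rewrite 2!(flowD flow_phi) -/w.
  - have -> : h (a + s') = h a + (s' - r) by lra.
    by rewrite 2!(flowD flow_phi) -/w.
have k4 := mdist_triangle (phi s' (phi a x)) (phi (h (a + s')) y) w.
rewrite (mdist_sym (phi (h (a + s')) y) (phi s' (phi a x))) in k4; lra.
Qed.

(** By [shadow_speed] the clock gains at least one half in each unit of time, so
it is unbounded in both directions. *)
Lemma shadow_surjective :
  exists2 e, 0 < e & forall x y h, continuous h -> shadows e x y h ->
    forall r, exists s, h s = r.
Proof.
have [e e0 he] := @shadow_speed (1 / 2) (divr_gt0 ltr01 (ltr0Sn _ _)).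
exists e => // x y h ch sh r.
have step a : h a + 1 / 2 <= h (a + 1).
  have := he x y h ch sh a 1; rewrite normr1 ler_norml.
  by move=> /(_ (lexx _)) /andP[]; lra.
have up n : h 0 + n%:R / 2 <= h n%:R.
  elim: n => [|n IH]; first by rewrite mul0r addr0.
  by rewrite -addn1 natrD; have := step n%:R; lra.
have down n : h (- n%:R) <= h 0 - n%:R / 2.
  elim: n => [|n IH]; first by rewrite mul0r subr0 oppr0.
  have := step (- n.+1%:R).
  by rewrite -addn1 natrD opprD addrNK; lra.
have [n hn] : exists n : nat, 2 * `|r - h 0| <= n%:R.
  exists (Num.truncn (2 * `|r - h 0|)).+1; rewrite ltW//.
  exact: truncnS_gt.
have hu := up n; have hd := down n.
have := ler_norm (r - h 0); have := ler_norm (- (r - h 0)).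
rewrite normrN => l1 l2.
have nn : - n%:R <= n%:R :> R by have := ler0n R n; lra.
have [c _ hc] : exists2 c, c \in `[- n%:R, n%:R] & h c = r.
  apply: IVT => //; first exact: continuous_subspaceT.
  have hle : h (- n%:R) <= h n%:R by have := ler0n R n; lra.
  by rewrite min_l// max_r//; apply/andP; split; lra.
by exists c.
Qed.

End no_fixed_points.

(** * Shadowing along 2-Lipschitz clocks *)

(** The factor [2] leaves room for clocks that advance by at most
[1 + eta <= 2] per unit of time. *)
Definition slow {R : realType} (h : R -> R) :=
  h 0 = 0 /\ forall s t, `|h s - h t| <= 2 * `|s - t|.

Lemma slow_continuous {R : realType} (h : R -> R) : slow h -> continuous h.
Proof.
move=> [_ hL] x; apply/cvgrPdist_le => /= e e0; near=> t.
rewrite (le_trans (hL _ _))// mulrC -ler_pdivlMr//.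
near: t; have /cvgrPdist_le := @cvg_id _ (nbhs x); apply.
by rewrite divr_gt0.
Unshelve. all: by end_near. Qed.

Lemma slow_bounded {R : realType} (h : R -> R) s : slow h -> `|h s| <= 2 * `|s|.
Proof. by move=> [h0 hL]; have := hL s 0; rewrite h0 !subr0. Qed.

(** Local control of the drift turns into linear growth, by walking from [a] to
[s] in unit steps. *)
Lemma drift_growth {R : realType} (h : R -> R) eta : eta <= 1 ->
  (forall a s, `|s| <= 1 -> `|h (a + s) - h a - s| <= eta) ->
  forall a s, h a <= h s + 2 * `|s - a| + eta.
Proof.
move=> eta1 hh a s.
have small b t : `|t - b| <= 1 -> h b <= h t + 2 * `|t - b| + eta.
  rewrite distrC => tb; have := hh t (b - t) tb.
  rewrite subrKC ler_norml => /andP[_ h1].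
  by have := ler_norm (b - t); have := normr_ge0 (b - t); rewrite distrC; lra.
suff K (n : nat) b t : `|t - b| <= n%:R -> h b <= h t + 2 * `|t - b| + eta.
  by apply: (K (Num.truncn `|s - a|).+1); rewrite ltW// truncnS_gt.
elim: n b t => [|n IH] b t tb; first by apply: small; rewrite (le_trans tb).
have [|tb1] := leP `|t - b| 1; first exact: small.
rewrite -addn1 natrD in tb.
(* one unit step from [b] towards [t] *)
have [bt|bt] := leP b t.
- have e1 : `|t - b| = t - b by rewrite ger0_norm// subr_ge0.
  have e2 : `|t - (b + 1)| = t - b - 1.
    by rewrite opprD addrA ger0_norm//; lra.
  have := IH (b + 1) t; rewrite e2 => /(_ ltac:(lra)).
  have := hh b 1; rewrite normr1 ler_norml => /(_ (lexx _)) /andP[]; lra.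
- have e1 : `|t - b| = b - t by rewrite ltr0_norm ?opprB// subr_lt0.
  have e2 : `|t - (b - 1)| = b - t - 1.
    by rewrite ler0_norm; lra.
  have := IH (b - 1) t; rewrite e2 => /(_ ltac:(lra)).
  have := hh b (- 1); rewrite normrN normr1 ler_norml.
  by move=> /(_ (lexx _)) /andP[]; lra.
Qed.

(** The smallest 2-Lipschitz function above [h], namely
[s |-> sup_a (h a - 2 * `|s - a|)], exceeds [h] by at most [eta] because of
[drift_growth]. Subtracting its value at [0] keeps the distance at most
[eta]. *)
Lemma slow_approximation {R : realType} (h : R -> R) eta :
  eta <= 1 -> h 0 = 0 ->
  (forall a s, `|s| <= 1 -> `|h (a + s) - h a - s| <= eta) ->
  exists2 k, slow k & forall s, `|k s - h s| <= eta.
Proof.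
move=> eta1 h00 hh; have hg := drift_growth eta1 hh.
pose A s := [set h a - 2 * `|s - a| | a in [set: R]].
pose g s := sup (A s).
have supA s : has_sup (A s).
  split; first by exists (h 0 - 2 * `|s - 0|), 0.
  by exists (h s + eta) => _ [a _ <-]; have := hg a s; lra.
have gub s a : h a - 2 * `|s - a| <= g s.
  by apply: ub_le_sup; [case: (supA s)|exists a].
have glub s c : (forall a, h a - 2 * `|s - a| <= c) -> g s <= c.
  by move=> hc; apply: ge_sup; [case: (supA s)|move=> _ [a _ <-]].
have g1 s : h s <= g s by have := gub s s; rewrite subrr normr0 mulr0 subr0.
have g2 s : g s <= h s + eta by apply: glub => a; have := hg a s; lra.
have gL s t : g s <= g t + 2 * `|s - t|.
  apply: glub => a; have := gub t a.
  by have := ler_distD s t a; rewrite (distrC t s); lra.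
exists (fun s => g s - g 0); first split.
- by rewrite subrr.
- move=> s t; rewrite opprB addrA subrK ler_norml.
  by have := gL s t; have := gL t s; rewrite (distrC t s); lra.
- move=> s; rewrite ler_norml.
  by have := g1 s; have := g1 0; have := g2 s; have := g2 0; rewrite h00; lra.
Qed.

Section slow_shadow.
Context {R : realType} {X : pointedMetricType R} (phi : R -> X -> X).
Context (compactX : compact [set: X]).
Context (flow_phi : continuous_flow phi).
Context (no_fixed_point : forall x : X, ~ fixed_point phi x).

Definition slow_shadow e x : set X :=
  [set y | exists2 h, slow h & shadows phi e x y h].

Lemma slow_shadow_sub_Gamma e x : slow_shadow e x `<=` Gamma_tilde phi e x.
Proof.
by move=> y [h hs sh]; exists h; split => //; [exact: slow_continuous|case: hs].
Qed.

(** The Lipschitz approximation changes the clock by at most [eta], hence moves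
the point on the orbit of [y] by at most [e' / 2]. *)
Lemma Gamma_sub_slow_shadow e' : 0 < e' ->
  exists2 e, 0 < e & forall x, Gamma_tilde phi e x `<=` slow_shadow e' x.
Proof.
move=> e'0; have e'2 : 0 < e' / 2 by rewrite divr_gt0.
have [d d0 hd] := flow_near_id compactX flow_phi e'2.
pose eta := Num.min 1 d.
have eta0 : 0 < eta by rewrite lt_min ltr01.
have [e e0 he] := shadow_speed compactX flow_phi no_fixed_point eta0.
exists (Num.min e (e' / 2)); first by rewrite lt_min e0.
move=> x y [h [ch h0 sh]].
have sh' : shadows phi e x y h.
  by move=> s; rewrite (le_trans (sh s))// ge_min lexx.
have [] := @slow_approximation _ h eta _ h0 (he x y h ch sh').
  by rewrite ge_min lexx.
move=> k sk hk; exists k => // s.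
have h1 : mdist (phi s x) (phi (h s) y) <= e' / 2.
  by rewrite (le_trans (sh s))// ge_min lexx orbT.
have h2 : mdist (phi (k s) y) (phi (h s) y) <= e' / 2.
  have -> : k s = h s + (k s - h s) by rewrite subrKC.
  rewrite (flowD flow_phi); apply: hd.
  by rewrite (le_trans (hk s))// ge_min lexx orbT.
have h3 := mdist_triangle (phi (h s) y) (phi s x) (phi (k s) y).
rewrite (mdist_sym (phi (h s) y) (phi (k s) y)) in h3; lra.
Qed.

Lemma slow_shadow_le e e' x : e <= e' -> slow_shadow e x `<=` slow_shadow e' x.
Proof.
by move=> ee y [h hs sh]; exists h => // s; exact: (le_trans (sh s)).
Qed.

(** A closed subset of a product of segments. *)
Lemma compact_slow : compact ([set h | slow h] : set {ptws R -> R}).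
Proof.
have cK : compact ([set h | forall s, h s \in `[- (2 * `|s|), 2 * `|s|]]
    : set {ptws R -> R}).
  apply: (@tychonoff R (fun=> R) (fun s => [set` `[- (2 * `|s|), 2 * `|s|]])).
  by move=> s; exact: segment_compact.
apply: (subclosed_compact _ cK); last first.
  by move=> h hs s; rewrite in_itv/= -ler_norml; exact: slow_bounded.
have pc (s : R) : continuous ((fun h => h s) : {ptws R -> R} -> R).
  exact: (@proj_continuous R (fun=> R) s).
have -> : [set h : {ptws R -> R} | slow h] = (fun h => h 0) @^-1` [set 0] `&`
    \bigcap_(p in [set: R * R])
      (fun h => h p.1 - h p.2) @^-1` [set r | `|r| <= 2 * `|p.1 - p.2|].
  apply/seteqP; split => h [h0 hL]; split => //; first by move=> p _; exact: hL.
  by move=> s t; exact: (hL (s, t)).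
apply: closedI.
  by move/continuous_closedP : (pc 0); apply; exact: closed_eq.
apply: closed_bigI => p _.
have /continuous_closedP : continuous
    ((fun h => `|h p.1 - h p.2|) : {ptws R -> R} -> R).
  move=> h; have fh := nbhs_filter h.
  have c := @cvgB _ _ _ _ fh _ _ _ _ (pc p.1 h) (pc p.2 h).
  exact: (@cvg_norm _ _ _ _ fh _ _ c).
by move/(_ [set r | r <= 2 * `|p.1 - p.2|]); apply; exact: closed_le.
Qed.

(** The projection along a compact set of clocks of a closed condition on the
clock and on both points. *)
Lemma closed_slow_shadow e :
  closed [set p : X * X | slow_shadow e p.1 p.2].
Proof.
rewrite -openC openE => -[x y]/= nxy.
have /compact_near_coveringP cS := compact_slow.
have K : \forall p \near (x, y), ([set h | slow h] : set {ptws R -> R}) `<=`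
    [set h | ~ shadows phi e p.1 p.2 h].
  apply: (cS _ _ (fun p h => ~ shadows phi e p.1 p.2 h)
    (nbhs_filter (x, y))) => h hs.
  have : ~ shadows phi e x y h by move=> sh; apply: nxy; exists h.
  move=> /existsNP[s /negP]; rewrite -ltNge => es.
  pose F := filter_prod (nbhs (h : {ptws R -> R})) (nbhs (x, y)).
  have FF : Filter F by apply: filter_prod_filter; exact: nbhs_filter.
  have cxy : q.2 @[q --> F] --> (x, y).
    exact: (@cvg_snd _ _ _ _ (nbhs_filter h)).
  have cx : q.2.1 @[q --> F] --> x by exact: (cvg_comp _ _ cxy cvg_fst).
  have cy : q.2.2 @[q --> F] --> y by exact: (cvg_comp _ _ cxy cvg_snd).
  have ch : q.1 @[q --> F] --> h.
    exact: (@cvg_fst _ _ _ _ (nbhs_filter (x, y))).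
  have chs : q.1 s @[q --> F] --> h s.
    exact: (cvg_comp _ _ ch (@proj_continuous R (fun=> R) s h)).
  have c : mdist (phi s q.2.1) (phi (q.1 s) q.2.2) @[q --> F] -->
      mdist (phi s x) (phi (h s) y).
    have k : (phi s q.2.1, phi (q.1 s) q.2.2) @[q --> F] -->
        (phi s x, phi (h s) y).
      apply: (@cvg_pair _ _ _ F (nbhs (phi s x)) (nbhs (phi (h s) y))).
        exact: (flow_cvg flow_phi FF (cvg_cst s) cx).
      exact: (flow_cvg flow_phi FF chs cy).
    exact: (cvg_comp _ _ k (@mdist_continuous _ _ (phi s x, phi (h s) y))).
  have := @cvgr_gt _ _ F FF _ _ c _ es.
  apply: filterS => -[k [x' y']]/= lt /(_ s)/=.
  by rewrite leNgt lt.
apply: filterS K => p pS [h hs sh].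
exact: (pS h hs).
Qed.

(** Reset the clocks at an instant [s0] with [h s0 = - t]: the point [y] then
follows [phi s0 x], and [phi q x] for [q] rational close to [s0]. *)
Lemma slow_shadow_shift e : 0 < e -> exists2 e', 0 < e' &
  forall t x, phi t @^-1` (slow_shadow e' x) `<=`
    \bigcup_(q : rat) slow_shadow e (phi (ratr q) x).
Proof.
move=> e0; have e20 : 0 < e / 2 by rewrite divr_gt0.
have [d d0 hd] := flow_near_id compactX flow_phi e20.
have [r r0 hr] := shadow_surjective compactX flow_phi no_fixed_point.
exists (Num.min r (e / 2)); first by rewrite lt_min r0.
move=> t x y [h hs sh].
have [s0 hs0] : exists s0, h s0 = - t.
  apply: (hr x (phi t y) h); first exact: slow_continuous.
  by move=> s; rewrite (le_trans (sh s))// ge_min lexx.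
have [q] : exists q : rat, s0 - d < ratr q < s0 + d.
  have := @rat_in_itvoo R (s0 - d) (s0 + d) ltac:(lra).
  by case=> q; rewrite in_itv/= => hq; exists q.
move=> hq; exists q => //.
exists (fun s => h (s0 + s) + t).
  split; first by rewrite addr0 hs0 addNr.
  move=> s u; rewrite opprD addrACA subrr addr0.
  by case: hs => _ /(_ (s0 + s) (s0 + u)); rewrite opprD addrACA subrr add0r.
move=> s; rewrite -(flowD flow_phi).
have h1 : mdist (phi (s0 + s) x) (phi (h (s0 + s) + t) y) <= e / 2.
  have := sh (s0 + s); rewrite -(flowD flow_phi) (addrC t) => /le_trans; apply.
  by rewrite ge_min lexx orbT.
have h2 : mdist (phi (ratr q + s) x) (phi (s0 + s) x) <= e / 2.
  have -> : ratr q + s = s0 + s + (ratr q - s0) by lra.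
  by rewrite (flowD flow_phi); apply: hd; rewrite ler_norml; lra.
have := mdist_triangle (phi (s0 + s) x) (phi (ratr q + s) x)
  (phi (h (s0 + s) + t) y).
lra.
Qed.

End slow_shadow.

(** * Borel probability measures and the weak* topology *)

Section borel_sets.
Context {R : realType} {X : pointedMetricType R}.

Lemma open_borel (A : set X) : open A -> measurable (A : set (borel X)).
Proof. by move=> oA; exact: sub_sigma_algebra. Qed.

Lemma closed_borel (A : set X) : closed A -> measurable (A : set (borel X)).
Proof.
move=> cA; rewrite -[A]setCK; apply: measurableC.
by apply: open_borel; rewrite openC.
Qed.

Lemma continuous_borel_real (f : X -> R) : continuous f ->
  measurable_fun [set: borel X] (f : borel X -> R).
Proof.
move=> /continuousP cf; apply: (measurability _ (RGenOpens.measurableE R)).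
move=> _ [_ [a [b ->] <-]]; rewrite setTI; apply: open_borel.
suff oab : open (`]a, b[%classic : set R) by exact: cf.
exact: interval_open.
Qed.

Lemma continuous_borel (g : X -> X) : continuous g ->
  measurable_fun [set: borel X] (g : borel X -> borel X).
Proof.
move=> /continuousP cg.
have h : @measurable _ (borel X) = <<s @open X >> by [].
apply: (measurability _ h).
by move=> _ [A oA <-]; rewrite setTI; apply: open_borel; exact: cg.
Qed.

Lemma continuous_integrable (compactX : compact [set: X])
    (mu : {finite_measure set (borel X) -> \bar R}) (f : X -> R) :
  continuous f -> mu.-integrable [set: borel X] (EFin \o f).
Proof.
move=> cf; apply: measurable_bounded_integrable => //.
- by rewrite ltey_eq fin_num_measure.
- exact: continuous_borel_real.
- exact: continuous_bounded.
Qed.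

Lemma outer_regular (mu : probability (borel X) R) (K : set X) (c : R) :
  closed K -> (mu K < c%:E)%E ->
  exists U : set X, [/\ open U, K `<=` U & (mu U < c%:E)%E].
Proof.
move=> cK muK.
pose U (n : nat) : set X := \bigcup_(z in K) (ball z n.+1%:R^-1)°.
have oU n : open (U n) by apply: bigcup_open => z _; exact: open_interior.
have KU n : K `<=` U n.
  by move=> z Kz; exists z => //; apply: nbhsx_ballx; rewrite invr_gt0.
have capU : \bigcap_n U n = K.
  apply/seteqP; split => [y Uy|y Ky n _]; last exact: KU.
  rewrite (closure_id K).1// => V /nbhs_ballP[e /= e0 eV].
  have [n ne] := @exists_invS_lt R e ltac:(by []).
  have [z Kz /interior_subset zy] := Uy n I; exists z; split => //; apply: eV.
  exact: (le_ball (ltW ne) (ball_sym zy)).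
have decU : nonincreasing_seq U.
  apply/nonincreasing_seqP => n; apply/subsetPset => y [z Kz zy].
  exists z => //.
  move: zy; apply: interiorS; apply: le_ball.
  by rewrite lef_pV2 ?posrE// ler_nat.
have h : mu \o U @ \oo --> mu K.
  rewrite -capU; apply: nonincreasing_cvg_mu => //.
  - by rewrite ltey_eq fin_num_measure//; exact: open_borel (oU _).
  - by move=> n; exact: open_borel (oU _).
  - by rewrite capU; exact: closed_borel.
have nK : nbhs (mu K) [set r | (r < c%:E)%E].
  by apply: open_nbhs_nbhs; split => //; exact: open_ereal_lt_ereal.
have [n _ hn] := h _ nK.
by exists (U n); split => //; exact: hn (leqnn n).
Qed.

End borel_sets.

Section weakstar.
Context {R : realType} {X : pointedMetricType R}.

Lemma cvg_initial (S : choiceType) (T : topologicalType) (f : S -> T) I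
    (F : set_system I) (u : I -> S) (s : S) : Filter F ->
  f (u i) @[i --> F] --> f s -> u @ F --> (s : initial_topology f).
Proof.
move=> FF h A [B [[C oC CB] Bs] BA].
apply: (@filterS _ _ _ (u @^-1` B)); first by move=> i /= /BA.
by rewrite -CB; apply: h; apply: open_nbhs_nbhs; split => //; rewrite -CB in Bs.
Qed.

(** Both layers of the weak* topology are initial topologies: for [integrate],
and for the evaluations that define pointwise convergence. *)
Lemma weakstar_cvg I (F : set_system I) (FF : Filter F)
    (u : I -> borelProbability X) (mu : borelProbability X) :
  (forall f : X -> R, continuous f ->
     (\int[u i]_x f x)%R @[i --> F] --> (\int[mu]_x f x)%R) ->
  u @ F --> mu.
Proof.
move=> h; apply: cvg_initial; apply/cvg_sup => f.
by apply: cvg_initial; apply: h; exact: cts_fun.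
Qed.

Lemma weakstar_eval_continuous (f : X -> R) (mu : borelProbability X) :
  continuous f -> {for mu, continuous
    (fun nu : borelProbability X => (\int[nu]_x f x)%R)}.
Proof.
move=> cf.
have c1 := @initial_continuous (probability (borel X) R) _ (@integrate R X) mu.
have c2 := @proj_continuous (continuousType X R) (fun=> R) (mkcts cf)
  (integrate mu).
exact: (cvg_comp _ _ c1 c2).
Qed.

(** Let [K x] be the section of [S] at [x] and [c'] a number between
[mu (K x)] and [c]. An open neighbourhood of [K x] with measure less than [c']
carries a continuous [f] with values between [0] and [1], equal to [1] on
[K x] and with integral less than [c']. The last property persists for [nu] near
[mu]. Since [S] is closed and the space is compact, [f] exceeds [c' / c] on
[K x'] for all [x'] near [x], so that [nu (K x') < c] by Markov's inequality.
Compactness makes the neighbourhood of [mu] independent of [x]. *)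
Lemma open_all_section_lt (compactX : compact [set: X]) (S : set (X * X))
    (c : R) :
  closed S ->
  open [set mu : borelProbability X |
    forall x, (mu [set y | S (x, y)] < c%:E)%E].
Proof.
move=> cS; rewrite openE => mu /= hmu.
move/compact_near_coveringP : (compactX) => cX.
have K : \forall nu \near mu, [set: X] `<=`
    [set x | ((nu : borelProbability X) [set y | S (x, y)] < c%:E)%E].
  apply: (cX _ (nbhs mu) (fun (nu : borelProbability X) x =>
    (nu [set y | S (x, y)] < c%:E)%E) (nbhs_filter mu)) => x _.
  pose K x : set X := [set y | S (x, y)].
  have cK z : closed (K z).
    have /continuous_closedP : continuous (fun y : X => (z, y)).
      by move=> y; apply: cvg_pair; [exact: cvg_cst|exact: cvg_id].
    exact.
  have muK : mu (K x) \is a fin_num.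
    exact: fin_num_measure _ _ (closed_borel (cK x)).
  have := hmu x; rewrite -/(K x) -(fineK muK) lte_fin => mc.
  pose c' := (fine (mu (K x)) + c) / 2.
  have m0 : 0 <= fine (mu (K x)) by rewrite fine_ge0.
  have c'0 : 0 < c' by rewrite /c'; lra.
  have c'c : c' < c by rewrite /c'; lra.
  have [U [oU KU muU]] : exists U : set X,
      [/\ open U, K x `<=` U & (mu U < c'%:E)%E].
    by apply: outer_regular => //; rewrite -(fineK muK) lte_fin /c'; lra.
  have US : uniform_separator (~` U) (K x).
    apply: (iffLR (@normal_separatorP R _)).
    - exact: (@pseudometric_normal R).
    - exact: open_closedC.
    - exact: cK.
    - by apply/seteqP; split => // y [nU /KU].
  pose f : X -> R := Urysohn (~` U) (K x).
  have cf : continuous f by exact: Urysohn_continuous.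
  have f01 y : 0 <= f y <= 1.
    have := @Urysohn_range X R (~` U) (K x) (f y); rewrite /= in_itv/=; apply.
    by exists y.
  have f1 y : K x y -> f y = 1.
    by move=> Ky; apply: (Urysohn_sub1 US); exists y.
  have f0 y : ~ U y -> f y = 0.
    by move=> Uy; apply: (Urysohn_sub0 US); exists y.
  have intf (nu : probability (borel X) R) :
      (\int[nu]_y (f y)%:E)%E \is a fin_num.
    by apply: integrable_fin_num => //; exact: continuous_integrable.
  have muf : (\int[mu]_y f y)%R < c'.
    rewrite -lte_fin /Rintegral (fineK (intf mu)); apply: le_lt_trans muU.
    rewrite -[X in (_ <= mu X)%E]setIT -integral_indic//;
      last exact: open_borel.
    apply: ge0_le_integral => //.
    - by move=> y _; rewrite lee_fin; case/andP: (f01 y).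
    - by apply/measurable_EFinP; exact: continuous_borel_real.
    - by apply/measurable_EFinP; apply: measurable_indic; exact: open_borel.
    - move=> y _; rewrite lee_fin indicE; case: (boolP (y \in U)) => [_|/negP].
        by case/andP: (f01 y).
      by rewrite inE => /f0 ->.
  pose a := c' / c.
  have c0 : 0 < c by lra.
  have a0 : 0 < a by rewrite divr_gt0.
  have a1 : a < 1 by rewrite ltr_pdivrMr// mul1r.
  have tube : \forall x' \near x, [set: X] `<=` [set y | K x' y -> a < f y].
    apply: (cX _ (nbhs x) (fun x' y => K x' y -> a < f y)) => y _.
    have [Sxy|Sxy] := pselect (S (x, y)).
      have fy : a < f y by rewrite f1.
      exists ([set y' | a < f y'], [set: X]); last by move=> [y' x'] [].
      split => /=; last exact: filterT.
      exact: (@cvgr_gt _ _ (nbhs y) _ f (f y) (cf y) _ fy).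
    move: cS; rewrite -openC openE => /(_ (x, y) Sxy) [[A B]] /= [Ax By] AB.
    exists (B, A) => // -[y' x'] /= [By' Ax'] Ky'.
    by case: (AB (x', y')).
  have nuf : \forall nu \near mu,
      (\int[(nu : borelProbability X)]_y f y)%R < c'.
    have ce := @weakstar_eval_continuous f mu cf.
    exact: (@cvgr_lt _ _ (nbhs mu) (nbhs_filter mu) _ _ ce _ muf).
  exists ([set x' | forall y, K x' y -> a < f y],
          [set nu : borelProbability X | (\int[nu]_y f y)%R < c']).
    by split => //=; apply: filterS tube => x' h y; exact: h.
  move=> [x' nu]/= [hx' hnu]; rewrite -/(K x').
  have nuK : nu (K x') \is a fin_num.
    exact: fin_num_measure _ _ (closed_borel (cK x')).
  have mK : measurable (K x' : set (borel X)) by exact: closed_borel.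
  have mf : measurable_fun [set: borel X] (fun y => (f y)%:E).
    by apply/measurable_EFinP; exact: continuous_borel_real.
  have f_ge0 y : (0 <= (f y)%:E)%E by rewrite lee_fin; case/andP: (f01 y).
  have : (a%:E * nu (K x') <= \int[nu]_y (f y)%:E)%E.
    rewrite -integral_cst//.
    apply: (@le_trans _ _ (\int[nu]_(y in K x') (f y)%:E)%E).
      apply: ge0_le_integral => //.
      - by move=> y _; rewrite lee_fin ltW.
      - exact: measurable_funTS.
      - by move=> y Ky; rewrite lee_fin ltW// hx'.
    exact: ge0_subset_integral.
  move: hnu; rewrite /Rintegral.
  rewrite -(fineK nuK) -(fineK (intf nu)) -EFinM lee_fin lte_fin.
  move=> h1 /le_lt_trans /(_ h1).
  by rewrite mulrC -ltr_pdivlMr// /a invf_div mulrCA divff ?mulr1// gt_eqF.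
apply: filterS K => nu h x; exact: h.
Qed.

End weakstar.

(** * Mixtures of probability measures *)

Section mixtures.
Context d {T : measurableType d} {R : realType}.

Lemma integral_mscale (m : {measure set T -> \bar R}) (k : {nonneg R})
    (f : T -> \bar R) : m.-integrable [set: T] f ->
  (\int[mscale k m]_x f x = k%:num%:E * \int[m]_x f x)%E.
Proof.
move=> fi; have /integrableP[mf _] := fi.
rewrite [LHS]integralE ge0_integral_mscale//; last exact: measurable_funepos.
rewrite ge0_integral_mscale//; last exact: measurable_funeneg.
have -> : (\int[m]_x f x = \int[m]_x f^\+ x - \int[m]_x f^\- x)%E.
  exact: integralE.
by rewrite [RHS]muleBr//; exact: integrable_add_def.
Qed.

Lemma binary_mixture (P Q : probability T R) (a : R) : 0 <= a <= 1 ->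
  exists M : probability T R,
    (forall A, M A = (1 - a)%:E * P A + a%:E * Q A)%E /\
    (forall f : T -> R, measurable_fun [set: T] f ->
      [bounded f x | x in [set: T]] ->
      \int[M]_x f x = (1 - a) * \int[P]_x f x + a * \int[Q]_x f x)%R.
Proof.
move=> /andP[a0 a1].
have b0 : 0 <= 1 - a by rewrite subr_ge0.
pose m : {measure set T -> \bar R} :=
  measure_add (mscale (NngNum b0) P) (mscale (NngNum a0) Q).
have mE A : (m A = (1 - a)%:E * P A + a%:E * Q A)%E.
  exact: measure_addE.
have m1 : m [set: T] = 1%E.
  by rewrite mE !probability_setT !mule1 -EFinD subrK.
pose M : probability T R :=
  HB.pack (Measure.sort m) (Measure_isProbability.Build _ _ _ m m1).
exists M; split => // f mf bf.
have fi (mu : {finite_measure set T -> \bar R}) :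
    mu.-integrable [set: T] (EFin \o f).
  apply: measurable_bounded_integrable => //.
  by rewrite ltey_eq fin_num_measure.
have fin (mu : {finite_measure set T -> \bar R}) :
    (\int[mu]_x (f x)%:E)%E \is a fin_num.
  by apply: integrable_fin_num => //; exact: fi.
apply: EFin_inj; rewrite EFinD !EFinM /Rintegral.
rewrite (fineK (fin M)) (fineK (fin P)) (fineK (fin Q)).
rewrite -[RHS]/((NngNum b0)%:num%:E * \int[P]_x (f x)%:E +
  (NngNum a0)%:num%:E * \int[Q]_x (f x)%:E)%E.
rewrite -(integral_mscale _ (fi P)) -(integral_mscale _ (fi Q)).
by apply: integral_measure_add;
  first [exact: fi | exact/measurable_EFinP | by []].
Qed.

(** The weights [1 / 2 ^ (n + 1)] add up to [1]. As all of them are positive,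
the mixture has no further null sets. *)
Lemma countable_mixture (P : nat -> probability T R) :
  exists M : probability T R,
    forall A, measurable A -> (M A = 0%E <-> forall n, P n A = 0%E).
Proof.
have w0 n : 0 <= 1 / (2 ^ (n + 1))%:R :> R by rewrite divr_ge0.
pose m : {measure set T -> \bar R} :=
  mseries (fun n => mscale (NngNum (w0 n)) (P n)) 0.
have mE A : m A = (\sum_(0 <= k <oo) (1 / (2 ^ (k + 1))%:R)%:E * P k A)%E by [].
have m1 : m [set: T] = 1%E.
  rewrite mE; under eq_eseriesr do rewrite probability_setT mule1.
  have := @cvg_geometric_eseries_half R 1 0; rewrite expr0 divr1.
  exact: cvg_lim.
pose M : probability T R :=
  HB.pack (Measure.sort m) (Measure_isProbability.Build _ _ _ m m1).
have pos k A : (0 <= (1 / (2 ^ (k + 1))%:R)%:E * P k A)%E.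
  by rewrite mule_ge0// lee_fin.
exists M => A mA; rewrite -[M A]/(m A) mE; split=> [h n|h]; last first.
  by apply: eseries0 => n _ _; rewrite h mule0.
apply/eqP; have : ((1 / (2 ^ (n + 1))%:R)%:E * P n A <= 0)%E.
  rewrite -h; apply: le_trans (nneseries_lim_ge n.+1 _); last first.
    by move=> k _ _; exact: pos.
  by rewrite big_nat_recr//= leeDr// sume_ge0.
by rewrite pmule_rle0 ?measure_le0// lte_fin divr_gt0// ltr0n expn_gt0//.
Qed.

End mixtures.

(** * Expansive measures form a countable union of G-delta sets *)

Section expansive_measures.
Context {R : realType} {X : pointedMetricType R} (phi : R -> X -> X).
Context (compactX : compact [set: X]).
Context (flow_phi : continuous_flow phi).
Context (no_fixed_point : forall x : X, ~ fixed_point phi x).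

Lemma closed_slow_shadow_at e x : closed (slow_shadow phi e x).
Proof.
have /continuous_closedP : continuous (fun y : X => (x, y)).
  by move=> y; apply: cvg_pair; [exact: cvg_cst|exact: cvg_id].
by move=> /(_ _ (@closed_slow_shadow _ _ _ flow_phi e)).
Qed.

Lemma measurable_slow_shadow e x :
  measurable (slow_shadow phi e x : set (borel X)).
Proof. by apply: closed_borel; exact: closed_slow_shadow_at. Qed.

(** The closed sets [slow_shadow phi e x] interlace with the sets
[Gamma_tilde phi e x], so the inner measure that defines expansivity may be
replaced by the measure. *)
Lemma expansiveP (mu : probability (borel X) R) : expansive phi mu <->
  exists2 e, 0 < e & forall x, mu (slow_shadow phi e x) = 0%E.
Proof.
split=> [[e e0 he]|[e' e'0 he]].
  exists e => // x; apply: (he x); first exact: measurable_slow_shadow.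
  exact: slow_shadow_sub_Gamma.
have [e e0 sub] := Gamma_sub_slow_shadow compactX flow_phi no_fixed_point e'0.
exists e => // x B mB Be; apply/eqP; rewrite -measure_le0 -(he x).
by apply: le_measure => //; rewrite ?inE//; [exact: measurable_slow_shadow|
  exact: subset_trans Be (sub x)].
Qed.

Lemma Gdelta_sigma_expansive :
  Gdelta_sigma [set mu : borelProbability X | expansive phi mu].
Proof.
pose V (n k : nat) := [set mu : borelProbability X |
  forall x, (mu (slow_shadow phi (n.+1%:R^-1)%R x) < (k.+1%:R^-1)%:E)%E].
exists (fun n => \bigcap_k V n k).
  move=> n; exists (V n) => // k.
  apply: (@open_all_section_lt _ _ compactX
    [set p | slow_shadow phi n.+1%:R^-1 p.1 p.2]).
  exact: closed_slow_shadow.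
apply/seteqP; split=> [mu /expansiveP[e e0 he]|mu [n _ hn]].
  have [n ne] := @exists_invS_lt R e ltac:(by []).
  exists n => // k _ x.
  apply: (@le_lt_trans _ _ (mu (slow_shadow phi e x))).
    apply: le_measure; rewrite ?inE; try exact: measurable_slow_shadow.
    exact: slow_shadow_le (ltW ne).
  by rewrite he lte_fin invr_gt0.
apply/expansiveP; exists n.+1%:R^-1; first by rewrite invr_gt0.
move=> x; apply/eqP; rewrite -measure_le0; apply/lee_addgt0Pr => _/posnumP[e].
rewrite add0e.
have [k ke] := @exists_invS_lt R e%:num ltac:(by []).
by apply/ltW/(lt_trans (hn k I x)); rewrite lte_fin.
Qed.

End expansive_measures.

(** * Approximation by expansive measures of invariant support *)

Section accumulation.
Context {R : realType} {X : pointedMetricType R} (phi : R -> X -> X).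
Context (compactX : compact [set: X]).
Context (flow_phi : continuous_flow phi).
Context (no_fixed_point : forall x : X, ~ fixed_point phi x).

(** Rational times suffice: they are dense, which gives an invariant support,
and countable, which makes a mixture with all weights positive possible. *)
Lemma orbit_mixture (mu : probability (borel X) R) :
  exists rho : probability (borel X) R, forall A, measurable A ->
    (rho A = 0%E <-> forall q : rat, mu (phi (ratr q) @^-1` A) = 0%E).
Proof.
pose g t : {mfun borel X >-> borel X} := HB.pack (phi t : borel X -> borel X)
  (isMeasurableFun.Build _ _ _ _ (phi t : borel X -> borel X)
    (continuous_borel (@flow_continuous _ _ _ flow_phi t))).
have [rho hrho] := countable_mixture
  (fun n => distribution mu (g (ratr (odflt 0 (unpickle n : option rat))))).
exists rho => A mA; rewrite hrho//; split => h.
  by move=> q; have := h (pickle q); rewrite pickleK.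
by move=> n; exact: h.
Qed.

(** Expansivity of all the images of [mu] under the flow, with a common
constant. *)
Lemma null_slow_shadow_preimage (mu : probability (borel X) R) e : 0 < e ->
  (forall x, mu (slow_shadow phi e x) = 0%E) ->
  exists2 e', 0 < e' & forall t x, mu (phi t @^-1` slow_shadow phi e' x) = 0%E.
Proof.
move=> e0 he.
have [e' e'0 sub] := slow_shadow_shift compactX flow_phi no_fixed_point e0.
exists e' => // t x.
pose q n : rat := odflt 0 (unpickle n).
have N : mu.-negligible (\bigcup_n slow_shadow phi e (phi (ratr (q n)) x)).
  apply: negligible_bigcup => n.
  exists (slow_shadow phi e (phi (ratr (q n)) x)).
  by split; [exact: measurable_slow_shadow|exact: he|].
apply: measure_negligible.
  rewrite -[X in measurable X]setTI.
  apply: (continuous_borel (@flow_continuous _ _ _ flow_phi t)) => //.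
  exact: measurable_slow_shadow.
apply: negligibleS N => y /sub[r _ ry]; exists (pickle r) => //=.
by rewrite /q pickleK.
Qed.

(** A neighbourhood of [phi t x] is also one of [phi q x] for [q] rational close
to [t]. *)
Lemma supp_flow_invariant (nu : probability (borel X) R) :
  (forall (q : rat) (U : set X), open U -> nu U = 0%E ->
     nu (phi (ratr q) @^-1` U) = 0%E) ->
  flow_invariant phi (supp nu).
Proof.
move=> null.
have sub t x : supp nu x -> supp nu (phi t x).
  move=> sx U oU Ux.
  have : \forall s \near t, U (phi s x).
    have c : phi s x @[s --> t] --> phi t x.
      by apply: (flow_cvg flow_phi); [exact: cvg_id|exact: cvg_cst].
    by apply: c; apply: open_nbhs_nbhs.
  move=> /nbhs_ballP[d /= d0 dU].
  have [q] := @rat_in_itvoo R (t - d) (t + d) ltac:(lra).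
  rewrite in_itv/= => tq.
  have Uq : U (phi (ratr q) x).
    by apply: dU; rewrite /ball/= distrC ltr_distl.
  have oq := flow_preimage_open flow_phi (ratr q) oU.
  have := sx _ oq Uq; rewrite !lt0e => /andP[nz _]; rewrite measure_ge0 andbT.
  by apply: contraNN nz => /eqP nU; apply/eqP; exact: null.
move=> t; apply/seteqP; split=> [_ [x sx <-]|x sx]; first exact: sub.
exists (phi (- t) x); first exact: sub.
by rewrite -(flowD flow_phi) addNr (flow0 flow_phi).
Qed.

(** The approximating measures are [(1 - a) mu + a rho] with [a = 1 / (n + 2)],
which lies strictly between [0] and [1]. *)
Lemma expansive_limit (mu : borelProbability X) : expansive phi mu ->
  exists nu : nat -> borelProbability X,
    (forall n, expansive phi (nu n) /\ flow_invariant phi (supp (nu n))) /\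
    nu @ \oo --> mu.
Proof.
move=> /(expansiveP compactX flow_phi no_fixed_point)[e e0 he].
have [e' e'0 he'] := null_slow_shadow_preimage e0 he.
have [rho hrho] := orbit_mixture mu.
have a01 n : 0 <= (n.+2%:R^-1 : R) <= 1.
  by rewrite invr_ge0 ler0n/= invf_le1// ler1n.
pose nu n : borelProbability X :=
  projT1 (cid (@binary_mixture _ _ _ mu rho _ (a01 n))).
have nuE n A :
    (nu n A = (1 - n.+2%:R^-1)%:E * mu A + (n.+2%:R^-1)%:E * rho A)%E.
  by rewrite /nu; case: cid => M [].
have nuI n (f : X -> R) : continuous f -> (\int[nu n]_x f x =
    (1 - n.+2%:R^-1) * \int[mu]_x f x + n.+2%:R^-1 * \int[rho]_x f x)%R.
  move=> cf; rewrite /nu; case: cid => P /= [_]; apply.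
    exact: continuous_borel_real.
  exact: continuous_bounded.
have nu0 n A : measurable A -> nu n A = 0%E <-> rho A = 0%E.
  move=> mA; rewrite nuE; split=> h.
    have /andP[_ h2] : (((1 - n.+2%:R^-1)%:E * mu A == 0) &&
        ((n.+2%:R^-1)%:E * rho A == 0))%E.
      rewrite -padde_eq0; first exact/eqP.
      - by rewrite mule_ge0// lee_fin subr_ge0; case/andP: (a01 n).
      - by rewrite mule_ge0.
    by move: h2; rewrite mule_eq0 eqe invr_eq0 pnatr_eq0/= => /eqP.
  have := (hrho A mA).1 h 0; rewrite h mule0 adde0 => mu0.
  rewrite -(_ : phi (ratr 0) @^-1` A = A) ?mu0 ?mule0//.
  by apply/seteqP; split => y /=; rewrite rmorph0 (flow0 flow_phi).
exists nu; split; last first.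
  apply: weakstar_cvg => f cf; under eq_fun do rewrite nuI//.
  have inv0 : (n.+2%:R^-1 : R) @[n --> \oo] --> 0.
    by have := @cvg_harmonic R; rewrite -cvg_shiftS.
  have : ((1 - n.+2%:R^-1) * \int[mu]_x f x + n.+2%:R^-1 * \int[rho]_x f x)%R
      @[n --> \oo] --> ((1 - 0) * \int[mu]_x f x + 0 * \int[rho]_x f x)%R.
    apply: cvgD; apply: cvgM => //; try exact: cvg_cst.
    by apply: cvgB => //; exact: cvg_cst.
  by rewrite subr0 mul1r mul0r addr0.
move=> n; split.
  apply/(expansiveP compactX flow_phi no_fixed_point); exists e' => // x.
  apply/nu0; first exact: measurable_slow_shadow.
  by apply/hrho => [|q]; [exact: measurable_slow_shadow|exact: he'].
apply: supp_flow_invariant => q U oU /nu0 h.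
have oq := flow_preimage_open flow_phi (ratr q) oU.
apply/nu0; first exact: open_borel.
apply/hrho; first exact: open_borel.
move=> r; have := (hrho U (open_borel oU)).1 (h (open_borel oU)) (r + q).
congr (mu _ = _); apply/seteqP; split => x /=;
  by rewrite rmorphD (flowD flow_phi).
Qed.

End accumulation.

Theorem theorem3 (R : realType) (X : pointedMetricType R) (phi : R -> X -> X)
    (compactX : compact [set: X])
    (flow_phi : continuous_flow phi)
    (no_fixed_point : forall x : X, ~ fixed_point phi x) :
  Gdelta_sigma [set mu : borelProbability X | expansive phi mu] /\
  (forall mu : borelProbability X, expansive phi mu ->
    exists nu : nat -> borelProbability X,
      (forall n, expansive phi (nu n) /\ flow_invariant phi (supp (nu n))) /\
      nu @ \oo --> mu).
Proof.
split; first exact: Gdelta_sigma_expansive.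
exact: expansive_limit.
Qed.
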